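(* Let $T$ be a complete $\mathcal L$-theory with monster model $\mathcal U$ and small $M\prec\mathcal U$. Let $\mu\in\mathfrak{M}_x^{\mathrm{inv}}(\mathcal{U},M)$ be $M$-adequate and let $\varphi(x,y)$ be an NIP $\mathcal L$-formula. Then $$\lim_{n\to\infty}\frac{1}{n!}\sum_{\sigma\in\mathrm{Sym}(n)}\mathbb{P}_\mu\big([O^\varphi_n(x_{\sigma(1)},\dots,x_{\sigma(n)})]\big)=0.$$
   Context: Keisler measures: $S_x(A)$ is the Stone space of complete types over $A$; a Keisler measure is a finitely additive probability measure on $\mathcal L(A)$-formulas in $x$, identified with its regular Borel extension to $S_x(A)$; $[\varphi]$ is the clopen set of types containing $\varphi$. $\mu\in\mathfrak M_x(\mathcal U)$ is $M$-invariant if $\mu(\varphi(x,a))=\mu(\varphi(x,b))$ for all $\mathcal L$-formulas $\varphi(x,y)$ and $a\equiv_M b$; these form $\mathfrak M^{\mathrm{inv}}_x(\mathcal U,M)$. For small $N'\supseteq M$ and an $\mathcal L(N')$-formula $\varphi(x,y)$, $F^\varphi_{\mu,N'}:S_y(N')\to[0,1]$, $q\mapsto\mu(\varphi(x,b))$, $b\models q$. Borel-definable over $M$: all $F^\varphi_{\mu,M}$ Borel. Morley product: $(\mu\otimes\nu)(\varphi(x,y))=\int_{S_y(N')}F^\varphi_{\mu,N'}\,d(\nu|_{N'})$, $N'\supseteq M$ small containing the parameters. $\mu^{(1)}=\mu(x_1)$, $\mu^{(n+1)}=\mu(x_{n+1})\otimes\mu^{(n)}(x_1,\dots,x_n)$.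 $M$-adequate: $\mu$ and all $\mu^{(n)}$ Borel-definable over $M$ and iterated Morley products of $\mu$ independent of parenthesization. $\mathbb P_\mu$ is the regular Borel probability measure on $S_{\mathbf x}(\mathcal U)$, $\mathbf x=(x_i)_{i\ge1}$, with $\mathbb P_\mu([\varphi(x_1,\dots,x_n)])=\mu^{(n)}(\varphi(x_1,\dots,x_n))$. $O^\varphi_n(x_1,\dots,x_n)=\exists y_1\dots y_n(\bigwedge_{1\le i\le j\le n}\varphi(x_i,y_j)\wedge\bigwedge_{1\le j<i\le n}\neg\varphi(x_i,y_j))$. $\varphi(x,y)$ is NIP if the family $\{\varphi(\mathcal U,b):b\in\mathcal U^y\}$ has finite VC-dimension. *)

(* Defs.v *)
From Stdlib Require List.
From HB Require Import structures.
From mathcomp Require Import all_boot all_order all_algebra all_fingroup.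
From mathcomp Require Import all_classical all_reals all_analysis.

Set Implicit Arguments.
Unset Strict Implicit.
Unset Printing Implicit Defensive.

Import Order.TTheory GRing.Theory Num.Theory.
Import numFieldNormedType.Exports.

Local Open Scope classical_set_scope.
Local Open Scope ring_scope.

Record language := Language {
  fsym : Type;
  farity : fsym -> nat;
  rsym : Type;
  rarity : rsym -> nat }.

(* The carrier is nonempty, as usual; [base] is a witness of that. *)
Record structure (L : language) := Structure {
  carrier :> Type;
  base : carrier;
  fun_interp : forall s : fsym L, ('I_(farity s) -> carrier) -> carrier;
  rel_interp : forall s : rsym L, ('I_(rarity s) -> carrier) -> Prop }.

Inductive term (L : language) (V : Type) : Type :=
| tvar (x : V)
| tapp (s : fsym L) (args : 'I_(farity s) -> term L V).

(* [formula L V]: L-formulas whose free variables are in V. The variable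
   bound by [fex] is the element [None] of [option V]. *)
Inductive formula (L : language) (V : Type) : Type :=
| ftrue
| feq (t1 t2 : term L V)
| frel (s : rsym L) (args : 'I_(rarity s) -> term L V)
| fnot (f : formula L V)
| fand (f g : formula L V)
| fex (f : formula L (option V)).

Arguments tvar {L V}.
Arguments tapp {L V}.
Arguments ftrue {L V}.
Arguments feq {L V}.
Arguments frel {L V}.
Arguments fnot {L V}.
Arguments fand {L V}.
Arguments fex {L V}.

Definition forr L V (f g : formula L V) : formula L V :=
  fnot (fand (fnot f) (fnot g)).

Fixpoint trename L V W (h : V -> W) (t : term L V) : term L W :=
  match t with
  | tvar x => tvar (h x)
  | tapp s args => tapp s (fun i => trename h (args i))
  end.

Fixpoint frename L V W (h : V -> W) (f : formula L V) : formula L W :=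
  match f with
  | ftrue => ftrue
  | feq t1 t2 => feq (trename h t1) (trename h t2)
  | frel s args => frel s (fun i => trename h (args i))
  | fnot f => fnot (frename h f)
  | fand f g => fand (frename h f) (frename h g)
  | fex f => fex (frename (omap h) f)
  end.

Definition mapl V W A (h : V -> W) (z : V + A) : W + A :=
  match z with inl x => inl (h x) | inr a => inr a end.

Definition mapr V A B (h : A -> B) (z : V + A) : V + B :=
  match z with inl x => inl x | inr a => inr (h a) end.

Fixpoint fex_ord L V k : formula L (V + 'I_k) -> formula L V :=
  match k with
  | 0%N => frename (fun z : V + 'I_0 => match z with
      | inl x => x
      | inr (Ordinal _ lt_i0) => False_rect V (notF lt_i0)
      end)
  | k'.+1 => fun f => fex_ord (fex (frename (fun z : V + 'I_k'.+1 =>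
      match z with
      | inl x => Some (inl x)
      | inr i => omap inr (unlift ord_max i)
      end) f))
  end.

Definition fexs L V (E : finType) (f : formula L (V + E)) : formula L V :=
  fex_ord (frename (mapr enum_rank) f).

Fixpoint teval L (U : structure L) V (v : V -> U) (t : term L V) : U :=
  match t with
  | tvar x => v x
  | tapp s args => fun_interp (fun i => teval v (args i))
  end.

Fixpoint sat L (U : structure L) V (v : V -> U) (f : formula L V) : Prop :=
  match f with
  | ftrue => True
  | feq t1 t2 => teval v t1 = teval v t2
  | frel s args => rel_interp (fun i => teval v (args i))
  | fnot f => ~ sat v f
  | fand f g => sat v f /\ sat v g
  | fex f => exists a, sat (fun o => if o is Some x then v x else a) f
  end.

Definition models L (U : structure L) (T : set (formula L void)) :=
  forall s, T s -> sat (of_void U) s.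

Definition entails L (T : set (formula L void)) (s : formula L void) :=
  forall U : structure L, models U T -> sat (of_void U) s.

Definition complete_theory L (T : set (formula L void)) :=
  (exists U : structure L, models U T) /\
  (forall s, entails T s \/ entails T (fnot s)).

Definition elementary L (N U : structure L) (e : N -> U) :=
  forall n (f : formula L 'I_n) (v : 'I_n -> N), sat v f <-> sat (e \o v) f.

Definition elementary_submodel L (U : structure L) (M : set U) :=
  exists (N : structure L) (e : N -> U), elementary e /\ range e = M.

Definition automorphism L (U : structure L) (e : U -> U) :=
  [/\ bijective e,
      forall s (v : 'I_(farity s) -> U),
        e (fun_interp v) = fun_interp (e \o v) &
      forall s (v : 'I_(rarity s) -> U),
        rel_interp v <-> rel_interp (e \o v)].

(* L(U)-formulas in variables V are formulas in V + U. *)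
Definition psat L (U : structure L) V (v : V -> U) (f : formula L (V + U)) :=
  sat (fun z => match z with inl x => v x | inr a => a end) f.

(* The parameters of f are in A, i.e., f is an L(A)-formula. *)
Definition over L (U : structure L) (A : set U) V (f : formula L (V + U)) :=
  exists g : formula L (V + A), frename (mapr set_val) g = f.

Definition nopar L (U : structure L) V (f : formula L V) : formula L (V + U) :=
  frename inl f.

(* phi(x,y) |-> phi(x,b) *)
Definition inst L (U : structure L) V W (f : formula L ((V + W) + U))
    (b : W -> U) : formula L (V + U) :=
  frename (fun z => match z with
                    | inl (inl x) => inl x
                    | inl (inr y) => inr (b y)
                    | inr a => inr a
                    end) f.

(* S_V(A); consistency is with the elementary diagram of U. *)
Record ctype L (U : structure L) (A : set U) (V : Type) := CType {
  tset :> formula L (V + U) -> Prop;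
  tset_over : forall f, tset f -> over A f;
  tset_consistent : forall s : seq (formula L (V + U)),
    (forall f, List.In f s -> tset f) ->
    exists v : V -> U, forall f, List.In f s -> psat v f;
  tset_complete : forall f, over A f -> tset f \/ tset (fnot f) }.

Definition realizes L (U : structure L) (A : set U) V (b : V -> U)
    (q : ctype A V) := forall f, q f -> psat b f.

Definition same_type L (U : structure L) (A : set U) V (a b : V -> U) :=
  forall f, over A f -> psat a f <-> psat b f.

Definition clopen_of L (U : structure L) (A : set U) V (f : formula L (V + U))
  : set (ctype A V) := [set q | q f].
Arguments clopen_of {L U} A {V} f.

Section stone_space.
Context (L : language) (U : structure L) (A : set U) (V : Type).
Local Notation S := (ctype A V).

Lemma over_true : over A (@ftrue L (V + U)).
Proof. by exists ftrue. Qed.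

Lemma over_not (f : formula L (V + U)) : over A f -> over A (fnot f).
Proof. by case=> g <-; exists (fnot g). Qed.

Lemma over_and (f g : formula L (V + U)) :
  over A f -> over A g -> over A (fand f g).
Proof. by move=> [f' <-] [g' <-]; exists (fand f' g'). Qed.

Lemma ctype_true (q : S) : q ftrue.
Proof.
have [//|nt] := tset_complete q over_true.
have [|v sv] := @tset_consistent _ _ _ _ q [:: fnot ftrue].
  by move=> f [<-|[]].
by have /(_ I) := sv (fnot ftrue) (or_introl erefl).
Qed.

Lemma ctype_and (q : S) f g : q (fand f g) <-> q f /\ q g.
Proof.
split=> [qfg|[qf qg]].
  have [fo go] : over A f /\ over A g.
    have [h] := tset_over qfg.
    by case: h => // f' g' [<- <-]; split; [exists f'|exists g'].
  split.
    have [//|nf] := tset_complete q fo.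
    have [|v sv] := @tset_consistent _ _ _ _ q [:: fand f g; fnot f].
      by move=> k [<-|[<-|[]]].
    have [sf _] := sv (fand f g) (or_introl erefl).
    by have /(_ sf) := sv (fnot f) (or_intror (or_introl erefl)).
  have [//|ng] := tset_complete q go.
  have [|v sv] := @tset_consistent _ _ _ _ q [:: fand f g; fnot g].
    by move=> k [<-|[<-|[]]].
  have [_ sg] := sv (fand f g) (or_introl erefl).
  by have /(_ sg) := sv (fnot g) (or_intror (or_introl erefl)).
have [//|nfg] := tset_complete q (over_and (tset_over qf) (tset_over qg)).
have [|v sv] := @tset_consistent _ _ _ _ q [:: f; g; fnot (fand f g)].
  by move=> k [<-|[<-|[<-|[]]]].
have sf := sv f (or_introl erefl).
have sg := sv g (or_intror (or_introl erefl)).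
by have /(_ (conj sf sg)) :=
  sv (fnot (fand f g)) (or_intror (or_intror (or_introl erefl))).
Qed.

Definition tp (v : V -> U) : S.
Proof.
apply: (@CType L U A V [set f | over A f /\ psat v f]).
- by move=> f [].
- by move=> s sp; exists v => f /sp[].
- move=> f fo; have [sf|nsf] := pselect (psat v f); first by left.
  by right; split; [exact: over_not|].
Defined.

HB.instance Definition _ := gen_eqMixin S.
HB.instance Definition _ := gen_choiceMixin S.
HB.instance Definition _ := isPointed.Build S (tp (fun=> base U)).

(* The topology with basis the sets [f]. *)
Definition topen (O : set S) :=
  forall q, O q -> exists2 f, q f & clopen_of A f `<=` O.

Lemma topenT : topen setT.
Proof. by move=> q _; exists ftrue => //; exact: ctype_true. Qed.

Lemma topenI : setI_closed topen.
Proof.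
move=> O P oO oP q [/oO[f qf fO] /oP[g qg gP]].
exists (fand f g); first exact/ctype_and.
by move=> r /ctype_and[rf rg]; split; [exact: fO|exact: gP].
Qed.

Lemma topen_bigU (I : Type) (F : I -> set S) :
  (forall i, topen (F i)) -> topen (\bigcup_i F i).
Proof.
move=> oF q [i _ /oF[f qf fF]]; exists f => // r rf.
by exists i => //; exact: fF.
Qed.

HB.instance Definition _ :=
  isOpenTopological.Build S topenT topenI topen_bigU.

End stone_space.

(* The cardinal kappa is that of the type K. *)
Definition smaller (K T : Type) (A : set T) := ~ ([set: K] #<= A)%card.

Definition saturated (K : Type) L (U : structure L) :=
  forall (A : set U), smaller K A ->
  forall n (q : ctype A 'I_n), exists b, realizes b q.

Definition strongly_homogeneous (K : Type) L (U : structure L) :=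
  forall (A : set U) (h : U -> U), smaller K A ->
  (forall n (f : formula L 'I_n) (v : 'I_n -> U),
     (forall i, A (v i)) -> sat v f <-> sat (h \o v) f) ->
  exists2 e : U -> U, automorphism e & forall a, A a -> e a = h a.

(* kappa > |L| + aleph_0, the number of L-formulas in countably many
   variables. *)
Definition monster (K : Type) L (T : set (formula L void)) (U : structure L) :=
  [/\ models U T, smaller K [set: formula L nat],
      saturated K U & strongly_homogeneous K U].

Definition borel (S : ptopologicalType) := g_sigma_algebraType (@open S).

Definition regular_measure (S : ptopologicalType) (R : realType)
    (P : probability (borel S) R) :=
  forall B : set (borel S), measurable B ->
    P B = ereal_sup [set P C | C in [set C : set S | compact C /\ C `<=` B]] /\
    P B = ereal_inf [set P O | O in [set O : set S | open O /\ B `<=` O]].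

Section keisler.
Context (L : language) (U : structure L) (R : realType).

Definition kfun (V : Type) := formula L (V + U) -> R.

Definition keisler V (mu : kfun V) :=
  [/\ forall f, 0 <= mu f,
      mu ftrue = 1,
      forall f g, (forall v, psat v f <-> psat v g) -> mu f = mu g &
      forall f g, (forall v, ~ (psat v f /\ psat v g)) ->
        mu (forr f g) = mu f + mu g].

Definition inv_measure (M : set U) V (mu : kfun V) :=
  forall n (f : formula L (V + 'I_n)) (a b : 'I_n -> U),
    same_type M a b -> mu (inst (nopar U f) a) = mu (inst (nopar U f) b).

(* A regular Borel measure on S_W(A) is determined by its values on the clopen
   sets: P is the regular Borel extension of the restriction of nu to A. *)
Definition borel_extension (A : set U) W (nu : kfun W)
    (P : probability (borel (ctype A W)) R) :=
  regular_measure P /\ forall f, over A f -> P (clopen_of A f) = (nu f)%:E.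

(* F^phi_{mu,A}; the value does not depend on the realization b when mu is
   invariant over a subset of A. *)
Definition fiber (A : set U) V W (mu : kfun V) (phi : formula L ((V + W) + U))
    (q : ctype A W) : R :=
  xget 0 [set mu (inst phi b) | b in [set b | realizes b q]].

Definition borel_definable (M : set U) V (mu : kfun V) :=
  inv_measure M mu /\
  forall n (phi : formula L ((V + 'I_n) + U)), over M phi ->
    measurable_fun setT (fiber mu phi : borel (ctype M 'I_n) -> R).

(* (mu (x) nu)(phi): the common value of the integrals over all the small
   sets N containing M and the parameters of phi. *)
Definition morley (K : Type) (M : set U) V W (mu : kfun V) (nu : kfun W)
    : kfun (V + W) := fun phi =>
  xget 0 [set r | exists (N : set U) (P : probability (borel (ctype N W)) R),
    [/\ M `<=` N, smaller K N, over N phi, borel_extension nu P &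
        r = \int[P]_q fiber mu phi q]].

(* mu read in the variables W through the renaming h. *)
Definition pullback V W (h : W -> V) (mu : kfun V) : kfun W :=
  fun f => mu (frename (mapl h) f).

Section powers.
Context (K : Type) (M : set U) (X : Type) (mu : kfun X).

(* [power n] is mu^(n+1); its variables x_1, ..., x_(n+1) are indexed from 0,
   each x_i being a tuple indexed by X. *)
Fixpoint power (n : nat) : kfun ('I_n.+1 * X) :=
  match n with
  | 0%N => pullback snd mu
  | n'.+1 => pullback (fun ix : 'I_n'.+2 * X =>
      match unlift ord_max ix.1 with
      | Some j => inr (j, ix.2)
      | None => inl ix.2
      end) (morley K M mu (@power n'))
  end.
Arguments power n _ : clear implicits.

Inductive paren := PLeaf | PNode of paren & paren.

Fixpoint leaves (t : paren) : nat :=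
  match t with
  | PLeaf => 1%N
  | PNode l r => (leaves r + leaves l)%N
  end.

(* The product of mu(x_n), ..., mu(x_1), in this order, parenthesized as t. *)
Fixpoint iterated (t : paren) : kfun ('I_(leaves t) * X) :=
  match t with
  | PLeaf => pullback snd mu
  | PNode l r =>
      pullback (fun ix : 'I_(leaves r + leaves l) * X =>
        match fintype.split ix.1 with
        | inl j => inr (j, ix.2)
        | inr j => inl (j, ix.2)
        end) (morley K M (@iterated l) (@iterated r))
  end.
Arguments iterated t _ : clear implicits.

Definition adequate :=
  [/\ borel_definable M mu,
      forall n, borel_definable M (power n) &
      forall (t : paren) n (e : leaves t = n.+1) f,
        iterated t f = power n (frename (mapl (fun ix => (cast_ord e ix.1, ix.2))) f)].

(* P is P_mu: a regular Borel measure is determined by its values on the clopen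
   sets, and every L(U)-formula in (x_i)_i involves only x_1, ..., x_(n+1) for
   some n. *)
Definition sequence_measure
    (P : probability (borel (ctype [set: U] (nat * X))) R) :=
  regular_measure P /\
  forall n (f : formula L (('I_n.+1 * X) + U)),
    P (clopen_of [set: U]
         (frename (mapl (fun ix => (nat_of_ord ix.1, ix.2))) f)) =
    (power n f)%:E.

End powers.

End keisler.

Arguments power {L U R} K M {X} mu n _.
Arguments iterated {L U R} K M {X} mu t _.

Definition shatters T (F : set (set T)) (A : set T) :=
  forall B, B `<=` A -> exists2 C, F C & A `&` C = B.

Definition finite_vc_dim T (F : set (set T)) :=
  exists d : nat, forall A, shatters F A -> (A #<= `I_d)%card.

Definition pair_asg (U X Y : Type) (a : X -> U) (b : Y -> U) (z : X + Y) : U :=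
  match z with inl x => a x | inr y => b y end.

Definition NIP L (U : structure L) X Y (phi : formula L (X + Y)) :=
  finite_vc_dim [set [set a | sat (pair_asg a b) phi] | b in [set: Y -> U]].

(* Variables: x_i (resp. y_j) is the tuple of the (i, x), x in X (resp. of the
   (j, y), y in Y). *)
Definition Oform L X (Y : finType) (phi : formula L (X + Y)) (n : nat)
    : formula L ('I_n * X) :=
  let at_ (i j : 'I_n) : formula L ('I_n * X + 'I_n * Y) :=
    frename (fun z => match z with inl x => inl (i, x) | inr y => inr (j, y) end)
      phi in
  fexs (fand
    (\big[fand/ftrue]_(i < n) \big[fand/ftrue]_(j < n | (i <= j)%N) at_ i j)
    (\big[fand/ftrue]_(i < n) \big[fand/ftrue]_(j < n | (j < i)%N) fnot (at_ i j))).

(* O_n(x_s(1), ..., x_s(n)) as an L(U)-formula in the variables (x_i)_i. *)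
Definition Operm L (U : structure L) X (Y : finType) (phi : formula L (X + Y))
    (n : nat) (s : 'S_n) : formula L (nat * X + U) :=
  nopar U (frename (fun ix => (nat_of_ord (s ix.1), ix.2)) (Oform phi n)).

(* Main.v *)
(* The bound is pointwise: in any realization of a type in (x_i), few orderings
   s satisfy O_n, and P only averages this count. If O_n(x_s(1), ..., x_s(n))
   holds then, for m <= n/2, the instance phi(x, y_m) separates x_s(1), ...,
   x_s(m) from x_s(m+1), ..., x_s(2m). Precompose s with the 2^m permutations
   that swap positions p and p + m for p in a chosen subset of {1, ..., m}:
   each success of O_n exhibits the complement of the chosen subset as the
   trace of an instance of phi on the fixed points x_s(1), ..., x_s(m). Cut
   {1, ..., m} into t blocks of size k greater than the VC-dimension; every
   block misses a trace, so at most a fraction (1 - 2^-k)^t of the swaps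
   succeeds, and averaging over s bounds the fraction of good orderings. *)
Require Import Defs.
From mathcomp Require Import all_boot all_order all_algebra all_fingroup.
From mathcomp Require Import all_classical all_reals all_analysis.
From mathcomp Require Import measurable_realfun zify.
Import Order.TTheory GRing.Theory Num.Theory.
Import numFieldNormedType.Exports.
Local Open Scope classical_set_scope.
Local Open Scope ring_scope.

Set Implicit Arguments.
Unset Strict Implicit.
Unset Printing Implicit Defensive.

(** * Semantics of renaming, iterated quantifiers and [Oform] *)

Lemma teval_rename L (U : structure L) V W (h : V -> W) (v : W -> U)
    (t : term L V) : teval v (trename h t) = teval (v \o h) t.
Proof. by elim: t => //= s args IH; congr fun_interp; apply/funext. Qed.

Lemma sat_rename L (U : structure L) V (f : formula L V) :
  forall W (h : V -> W) (v : W -> U), sat v (frename h f) <-> sat (v \o h) f.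
Proof.
elim: f => {V} [V|V t1 t2|V s args|V f IH|V f IHf g IHg|V f IH] W h v //=.
- by rewrite !teval_rename.
- by under eq_fun do rewrite teval_rename.
- by have [ih hi] := IH _ h v; split=> nf /[dup] ? ?; apply: nf; auto.
- by have [? ?] := IHf _ h v; have [? ?] := IHg _ h v; split=> -[]; auto.
- have E a : (fun o => if o is Some x then v x else a) \o omap h =
      (fun o : option V => if o is Some x then (v \o h) x else a).
    by apply/funext => -[].
  by split=> -[a sa]; exists a; move: sa; rewrite IH E.
Qed.

Lemma sat_fex_ord L (U : structure L) V k (f : formula L (V + 'I_k))
    (v : V -> U) :
  sat v (fex_ord f) ->
  exists b : 'I_k -> U, sat (fun z => match z with inl x => v x
                                      | inr i => b i end) f.
Proof.
elim: k f => [|k IH] f /=.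
  (* ['I_0] is empty, so the value [base U] is never read. *)
  rewrite sat_rename => vf; exists (fun=> base U); congr sat: vf.
  by apply/funext => -[//|[]].
move=> /IH[b /= [a]]; rewrite sat_rename => abf.
(* The innermost quantifier binds the index [ord_max], with witness [a]; the other indices are read
   from [b]. *)
exists (fun i => if unlift ord_max i is Some j then b j else a).
congr sat: abf; apply/funext => -[//|i] /=.
by case: (unlift ord_max i).
Qed.

Lemma sat_fexs L (U : structure L) V (E : finType) (f : formula L (V + E))
    (v : V -> U) :
  sat v (fexs f) ->
  exists b : E -> U, sat (fun z => match z with inl x => v x
                                   | inr e => b e end) f.
Proof.
move=> /sat_fex_ord[b]; rewrite sat_rename => bf; exists (b \o enum_rank).
by congr sat: bf; apply/funext => -[].
Qed.

Lemma sat_bigand L (U : structure L) V (I : finType) (Q : pred I)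
    (F : I -> formula L V) (v : V -> U) :
  sat v (\big[fand/ftrue]_(i | Q i) F i) -> forall i, Q i -> sat v (F i).
Proof.
move=> vF i; move: (mem_index_enum i) vF; elim: (index_enum I) => // j r IH.
rewrite inE big_cons => /orP[/eqP <- + Qi|ir]; first by rewrite Qi => -[].
by case: ifP => [_ []|_] *; exact: IH.
Qed.

Lemma sat_Oform L (U : structure L) X (Y : finType) (phi : formula L (X + Y))
    n (v : 'I_n * X -> U) :
  sat v (Oform phi n) ->
  exists b : 'I_n -> Y -> U, forall i j,
    sat (pair_asg (fun x => v (i, x)) (b j)) phi <-> (i <= j)%N.
Proof.
move=> /sat_fexs[b [sle slt]]; exists (fun j y => b (j, y)) => i j.
have E : pair_asg (fun x => v (i, x)) (fun y => b (j, y)) =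
    (fun z => match z with inl x => v x | inr e => b e end) \o
    (fun z => match z with inl x => inl (i, x) | inr y => inr (j, y) end).
  by apply/funext => -[].
have [ij|ji] := leqP i j; split=> //.
  have := sat_bigand (i := j) (sat_bigand (i := i) sle isT) ij.
  by rewrite sat_rename -E.
have := sat_bigand (i := j) (sat_bigand (i := i) slt isT) ji.
by rewrite /= sat_rename -E.
Qed.

Lemma In_map (I : eqType) (T : Type) (f : I -> T) (r : seq I) y :
  List.In y [seq f x | x <- r] <-> exists2 x, x \in r & f x = y.
Proof.
elim: r => [|x r IH] /=; first by split=> // -[].
rewrite IH; split=> [[<-|[z zr <-]]|[z + <-]].
- by exists x; rewrite ?mem_head.
- by exists z; rewrite // inE zr orbT.
- by rewrite inE => /orP[/eqP ->|zr]; [left|right; exists z].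
Qed.

Lemma psat_Operm L (U : structure L) X (Y : finType) (phi : formula L (X + Y))
    n (s : 'S_n) (v : nat * X -> U) :
  psat v (Operm U phi s) <->
  sat (fun ix => v (nat_of_ord (s ix.1), ix.2)) (Oform phi n).
Proof. by rewrite /psat !sat_rename. Qed.

(** * Finite VC dimension and counting *)

(** If every subset were a trace, the singletons would force [a] to be injective, and the d + 1
    points of its range would be shattered. Hence [a] may have repetitions. *)
Lemma missed_trace (T : Type) (F : set (set T)) d
    (vcF : forall A, shatters F A -> (A #<= `I_d)%card) (a : 'I_d.+1 -> T) :
  exists b : {set 'I_d.+1},
    forall C, F C -> ~ (forall j, C (a j) <-> j \in b).
Proof.
apply/not_existsP => traces.
have tr (b : {set 'I_d.+1}) : exists2 C, F C & forall j, C (a j) <-> j \in b.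
  by have /existsNP[C /not_implyP[FC /contrapT aC]] := traces b; exists C.
have a_inj : injective a.
  move=> j j' ajj'; have [C _ Cb] := tr [set j]%SET.
  have : C (a j) by apply/Cb; rewrite inE.
  by rewrite ajj' => /Cb; rewrite inE => /eqP.
have /vcF : shatters F (range a).
  move=> B Bsub; have [C FC Cb] := tr [set j | `[< B (a j) >]]%SET.
  exists C => //; apply/seteqP; split=> [_ [[j _ <-]]|x Bx].
    by move=> /Cb; rewrite inE => /asboolP.
  have [j _ jx] := Bsub _ Bx; split; first by exists j.
  by rewrite -jx; apply/Cb; rewrite inE; apply/asboolP; rewrite jx.
have /card_le_trans/[apply] : (`I_d.+1 #<= range a)%card.
  have -> : range a = (a \o inord) @` `I_d.+1.
    apply/seteqP; split=> [_ [j _ <-]|_ [j _ <-]]; last by exists (inord j).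
    by exists j => //=; rewrite inord_val.
  rewrite (card_le_eqr (inj_card_eq _))// => i j.
  rewrite !inE => id jd /a_inj /(congr1 val).
  by rewrite /= !inordK.
by rewrite card_le_II ltnn.
Qed.

Lemma card_sets (J : finType) : #|{set J}| = (2 ^ #|J|)%N.
Proof. by rewrite -[#|J|]cardsT -card_powerset finset.powersetT cardsT. Qed.

(** Choosing one avoided value for each [i] puts [A] inside a product of |I| sets of size 2^|J| -
    1. *)
Lemma card_blockwise_avoiding (I J : finType) (A : {set {ffun I -> {set J}}}) :
  (forall i, exists b, forall g, g \in A -> g i != b) ->
  (#|A| <= (2 ^ #|J| - 1) ^ #|I|)%N.
Proof.
move=> /choice[b Ab].
have /subset_leq_card/leq_trans : A \subset family (fun i => predC1 (b i)).
  by apply/fintype.subsetP => g gA; apply/familyP => i; rewrite inE Ab.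
apply; rewrite card_family.
have -> : [seq #|predC1 (b i)| | i : I] = nseq #|I| (2 ^ #|J| - 1)%N.
  rewrite -(size_image (fun i => #|predC1 (b i)|) I).
  apply/all_pred1P/allP => _ /mapP[i _ ->] /=.
  by rewrite cardC1 card_sets subn1.
by elim: #|I| => //= m IH; rewrite expnS leq_mul2l IH orbT.
Qed.

(** Double count the pairs (g, s) with [w g * s] in [A]: translation is a bijection, so each g
    contributes |A|, while each s contributes at most [N]. *)
Lemma card_translates (gT : finGroupType) (A : {set gT}) (I : finType)
    (w : I -> gT) N :
  (forall s, #|[set g | (w g * s)%g \in A]%SET| <= N)%N ->
  (#|A| * #|I| <= N * #|gT|)%N.
Proof.
move=> AN; rewrite mulnC -sum_nat_const.
have -> : (\sum_(g : I) #|A| = \sum_(g : I) \sum_s ((w g * s)%g \in A))%N.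
  apply: eq_bigr => g _; rewrite -sum1_card big_mkcond /=.
  by rewrite (reindex_inj (mulgI (w g))).
rewrite exchange_big /= mulnC -sum_nat_const; apply: leq_sum => s _.
apply: leq_trans (AN s); rewrite -sum1_card [leqRHS]big_mkcond /=.
by apply: leq_sum => g _; rewrite inE; case: ifP.
Qed.

(** Product of the disjoint transpositions of p and p + m, over the p < m satisfying [h]. Working on
    [nat] delays the bound by n until the permutation is formed. *)
Definition block_swap m (h : pred nat) p : nat :=
  if (p < m)%N then (if h p then p + m else p)%N
  else if (p < m + m)%N && h (p - m)%N then (p - m)%N else p.

Lemma block_swapK m h : involutive (block_swap m h).
Proof.
move=> p; rewrite /block_swap.
have [pm|mp] := ltnP p m.
  by case hp: (h p); rewrite ?pm ?hp// addnK hp ltn_add2r pm ltnNge leq_addl.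
have [pmm|mmp] /= := ltnP p (m + m); last by rewrite !ltnNge mp mmp.
case hp: (h (p - m)%N); last by rewrite ltnNge mp pmm hp.
by rewrite hp subnK// ltn_subLR// pmm.
Qed.

Lemma block_swap_perm n m h : (m + m <= n)%N ->
  {w : 'S_n | forall i, w i = block_swap m h i :> nat}.
Proof.
move=> mn; have lt (i : 'I_n) : (block_swap m h i < n)%N.
  by rewrite /block_swap; have := ltn_ord i; do !case: ifP; lia.
have inj : injective (fun i => Ordinal (lt i)).
  move=> i j /(congr1 val) /= /(can_inj (block_swapK m h)); exact: val_inj.
by exists (perm inj) => i; rewrite permE.
Qed.

(** * Good orderings of one realization, and their average *)

Lemma open_clopen_of L (U : structure L) (A : set U) V
    (f : formula L (V + U)) : open (clopen_of A f).
Proof.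
have : topen (clopen_of A f) by move=> q qf; exists f.
by [].
Qed.

Lemma card_order_permutations L (U : structure L) (X Y : finType)
    (phi : formula L (X + Y)) d n t (v : nat * X -> U) (A : {set 'S_n}) :
  (forall B,
    shatters [set [set a | sat (pair_asg a b) phi] | b in [set: Y -> U]] B ->
    (B #<= `I_d)%card) ->
  (t.+1 * d.+1 + t.+1 * d.+1 <= n)%N ->
  (forall s, s \in A -> psat v (Operm U phi s)) ->
  (#|A| * (2 ^ d.+1) ^ t.+1 <= (2 ^ d.+1 - 1) ^ t.+1 * n`!)%N.
Proof.
set m := (t.+1 * d.+1)%N => vc mn Av.
(* Position p is the offset p mod (d + 1) in block p div (d + 1). It is swapped when [g] leaves its
   offset out, so that the trace on block i is [g i] itself. *)
pose h (g : {ffun 'I_t.+1 -> {set 'I_d.+1}}) p :=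
  inord (p %% d.+1) \notin g (inord (p %/ d.+1)).
pose w g := sval (block_swap_perm (h g) mn).
have wE g i : w g i = block_swap m (h g) i :> nat.
  by rewrite /w; case: block_swap_perm.
have := @card_translates _ A _ w ((2 ^ d.+1 - 1) ^ t.+1)%N.
rewrite card_ffun card_Sn card_sets !card_ord -card_Sn; apply=> s.
have := @card_blockwise_avoiding 'I_t.+1 'I_d.+1.
rewrite !card_ord; apply=> i.
have m_gt0 : (0 < m)%N by rewrite muln_gt0.
have pos_lt (j : 'I_d.+1) : (i * d.+1 + j < m)%N.
  by rewrite /m; have := ltn_ord i; have := ltn_ord j; nia.
have lo_lt (j : 'I_d.+1) : (i * d.+1 + j < n)%N by have := pos_lt j; lia.
have hi_lt (j : 'I_d.+1) : (i * d.+1 + j + m < n)%N by have := pos_lt j; lia.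
have mid_lt : (m.-1 < n)%N by lia.
pose lo j : 'I_n := Ordinal (lo_lt j); pose hi j : 'I_n := Ordinal (hi_lt j).
have hE g (j : 'I_d.+1) : h g (i * d.+1 + j)%N = (j \notin g i).
  by rewrite /h modnMDl divnMDl// modn_small// divn_small// addn0 !inord_val.
(* These points do not depend on [g], so a single missed subset serves for all [g]. *)
pose a j x := v (nat_of_ord (s (lo j)), x).
have [b nb] := missed_trace vc a; exists b => g; rewrite inE => /Av.
rewrite psat_Operm => /sat_Oform[y sy].
apply/eqP => gib.
(* In the reordered sequence, phi(x, y_m) holds exactly at the positions below m; counted from 0,
   y_m has index m - 1. *)
apply: (nb _ (ex_intro2 _ _ (y (Ordinal mid_lt)) I erefl)) => j.
(* By [permM], [w g] acts on positions before [s]: the point [a j] sits at [lo j] < m if j is in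
   [g i], and at [hi j] >= m otherwise. *)
rewrite -gib /=; case: (boolP (j \in g i)) => jg.
  have wlo : w g (lo j) = lo j.
    by apply: ord_inj; rewrite wE /block_swap /= pos_lt hE jg.
  have /= := sy (lo j) (Ordinal mid_lt); rewrite permM wlo => ->.
  by split=> // _; have := pos_lt j; lia.
have whi : w g (hi j) = lo j.
  apply: ord_inj; rewrite wE /block_swap /= addnK hE jg ltn_add2r pos_lt /=.
  by rewrite ltnNge leq_addl.
have /= := sy (hi j) (Ordinal mid_lt); rewrite permM whi => ->.
by split=> //; lia.
Qed.

(** The sum is the integral of the counting function, which is at most [c] pointwise, and [P] has
    mass 1. *)
Lemma sum_probability_le {disp : measure_display} {T : measurableType disp}
    {R : realType} (P : probability T R) (I : finType) (A : I -> set T) (c : R) :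
  (forall i, measurable (A i)) -> (forall x, \sum_i \1_(A i) x <= c) ->
  \sum_i fine (P (A i)) <= c.
Proof.
move=> mA Ac; rewrite -lee_fin -sumEFin.
under eq_bigr => i _ do
  rewrite fineK ?fin_num_measure// -[A i]setIT -integral_indic//.
rewrite -ge0_integral_sum//; last first.
  by move=> i; apply/measurable_EFinP; exact: measurable_indic.
rewrite -[leRHS]mule1 -(@probability_setT _ _ _ P) -integral_cst//.
apply: ge0_le_integral => //.
- by move=> x _; rewrite sume_ge0.
- apply: emeasurable_sum => i; apply/measurable_EFinP; exact: measurable_indic.
- by move=> x _; rewrite sumEFin lee_fin.
Qed.

Unset Implicit Arguments.

Theorem theorem6p19 (R : realType) (L : language) (T : set (formula L void))
  (K : Type) (U : structure L) (M : set U) (X Y : finType) (mu : kfun U R X)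
  (P : probability (borel (ctype [set: U] (nat * X))) R)
  (phi : formula L (X + Y)) :
  complete_theory T -> monster K T U ->
  smaller K M -> elementary_submodel M ->
  keisler mu -> inv_measure M mu -> adequate K M mu ->
  sequence_measure K M mu P ->
  NIP U phi ->
  (fun n : nat => (n`!%:R)^-1 *
     \sum_(s : 'S_n) fine (P (clopen_of [set: U] (Operm U phi s))))
    @ \oo --> (0 : R).
Proof.
move=> _ _ _ _ _ _ _ _ [d vc].
(* The factor 1 - 2^-(d+1) contributed by each block, one of whose 2^(d+1) subsets is missed. *)
pose r : R := (2 ^ d.+1 - 1)%N%:R / (2 ^ d.+1)%N%:R.
have r_lt1 : `|r| < 1.
  rewrite ger0_norm ?divr_ge0// ltr_pdivrMr ?ltr0n ?expn_gt0// mul1r ltr_nat.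
  by rewrite ltn_subrL expn_gt0.
have bound n t : (t.+1 * d.+1 + t.+1 * d.+1 <= n)%N ->
    (n`!%:R)^-1 *
      \sum_(s : 'S_n) fine (P (clopen_of [set: U] (Operm U phi s))) <=
    r ^+ t.+1.
  move=> tn; rewrite ler_pdivrMl ?ltr0n ?fact_gt0// mulrC.
  apply: sum_probability_le => [s|q].
    by apply: sub_sigma_algebra; exact: open_clopen_of.
  pose A := [set s : 'S_n | `[< q (Operm U phi s) >]]%SET.
  (* The type [q] need not be realized in [U], but the finitely many formulas indexed by [A] have a
     common realization. *)
  have [_ /In_map[s + <-]|v vA] :=
      @tset_consistent _ _ _ _ q [seq Operm U phi s | s <- enum A].
    by rewrite mem_enum inE => /asboolP.
  have {}vA s : s \in A -> psat v (Operm U phi s).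
    by move=> sA; apply/vA/In_map; exists s; rewrite ?mem_enum.
  have cA := card_order_permutations vc tn vA.
  have -> : \sum_(s : 'S_n) \1_(clopen_of [set: U] (Operm U phi s)) q =
      #|A|%:R :> R.
    rewrite -sum1_card natr_sum [RHS]big_mkcond /=; apply: eq_bigr => s _.
    rewrite indicE inE; case: asboolP => qs; first by rewrite mem_set.
    by rewrite memNset.
  rewrite expr_div_n mulrAC ler_pdivlMr ?exprn_gt0 ?ltr0n ?expn_gt0//.
  by rewrite -!natrX -!natrM ler_nat.
apply/cvgrPdist_lt => e e0.
have /cvgrPdist_lt/(_ e e0)[t _ te] := cvg_expr r_lt1.
(* Beyond this threshold there is room for two halves, each made of t + 1 blocks of size d + 1. *)
exists (t.+1 * d.+1 + t.+1 * d.+1)%N => // n /= tn.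
rewrite sub0r normrN ger0_norm; last first.
  by rewrite mulr_ge0// sumr_ge0// => s _; rewrite fine_ge0.
apply: le_lt_trans (bound _ _ tn) _.
have := te t.+1 (leqnSn t); rewrite /= sub0r normrN.
exact: le_lt_trans (ler_norm _).
Qed.
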